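(* Let $\mathfrak n$ be a nilpotent Lie algebra which satisfies $E_\infty^{0,2}(\mathfrak n)=0$. Then, for every integer $s\ge 0$, the Lie algebra $\mathbb R^s\oplus\mathfrak n$ (direct sum of $\mathfrak n$ with the abelian Lie algebra $\mathbb R^s$) does not admit symplectic structures.
   Context: All Lie algebras are real and finite-dimensional. For a Lie algebra $\mathfrak g$, the central descending series is $\mathfrak g^0=\mathfrak g$, $\mathfrak g^i=[\mathfrak g,\mathfrak g^{i-1}]$ for $i\ge 1$; $\mathfrak g$ is $k$-step nilpotent (nilpotency index $k$) if $\mathfrak g^k=0$ and $\mathfrak g^{k-1}\ne 0$. Abelian Lie algebras are 1-step nilpotent. The Chevalley–Eilenberg differential $d:\Lambda^p\mathfrak g^*\to\Lambda^{p+1}\mathfrak g^*$ (trivial real coefficients) is $$dc(x_1,\dots,x_{p+1})=\sum_{1\le i<j\le p+1}(-1)^{i+j-1}c([x_i,x_j],x_1,\dots,\hat{x_i},\dots,\hat{x_j},\dots,x_{p+1}).$$ A symplectic structure on a Lie algebra $\mathfrak g$ is a skew-symmetric bilinear form $\omega\in\Lambda^2\mathfrak g^*$ which is closed ($d\omega=0$) and non-degenerate. For a nilpotent Lie algebra $\mathfrak n$ of nilpotency index $k$, define subspaces of $\mathfrak n^*$ by $V_0=0$ and $V_i=\{\alpha\in\mathfrak n^*: d\alpha\in\Lambda^2V_{i-1}\}$ for $i\ge1$; $V_i$ is the annihilator of $\mathfrak n^i$, and $V_k=\mathfrak n^*$. The subcomplexes $F^pC^*=\Lambda^*V_{k-p}$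 filter the Chevalley–Eilenberg complex of $\mathfrak n$, and the intermediate cohomology groups $E_\infty^{p,q}(\mathfrak n)$ are the limit terms of the resulting spectral sequence, which converges to the Lie algebra cohomology of $\mathfrak n$. In particular $$E_\infty^{0,2}(\mathfrak n)\cong\frac{\{x\in\Lambda^2\mathfrak n^*:dx=0\}}{\{x\in\Lambda^2V_{k-1}:dx=0\}} .$$
   Formalization: The formal theorem assumes dim n ≥ 2; the claim fails for the one-dimensional n = R, where Λ²n* = 0 gives E_∞^{0,2}(n) = 0 but R ⊕ R = R² is symplectic. *)

(* Defs.v *)
From HB Require Import structures.
From mathcomp Require Import all_boot all_order all_algebra.
From mathcomp Require Import boolp classical_sets functions reals.

Set Implicit Arguments.
Unset Strict Implicit.
Unset Printing Implicit Defensive.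

Import Order.TTheory GRing.Theory Num.Theory.
Local Open Scope classical_set_scope.
Local Open Scope ring_scope.

(** * Finite-dimensional Lie algebras *)

HB.mixin Record isLieAlgebra (R : fieldType) L of Vector R L := {
  lie : L -> L -> L;
  lie_linearl : forall y, linear (lie^~ y);
  lie_linearr : forall x, linear (lie x);
  liexx : forall x, lie x x = 0;
  lie_jacobi : forall x y z,
    lie x (lie y z) + lie y (lie z x) + lie z (lie x y) = 0
}.

#[short(type="lieAlgType")]
HB.structure Definition LieAlgebra (R : fieldType) :=
  {L of Vector R L & isLieAlgebra R L}.

(* An alias, so that the zero bracket is not attached to matrices, which have
   the commutator bracket as well. *)
Definition abelian_lie (R : fieldType) (s : nat) : Type := 'rV[R]_s.

Section AbelianLie.
Variables (R : fieldType) (s : nat).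

HB.instance Definition _ := Vector.copy (abelian_lie R s) 'rV[R]_s.

Definition abelian_bracket (x y : abelian_lie R s) : abelian_lie R s := 0.

Fact abelian_linearl y : linear (abelian_bracket^~ y).
Proof. by move=> a u v; rewrite /abelian_bracket scaler0 addr0. Qed.
Fact abelian_linearr x : linear (abelian_bracket x).
Proof. by move=> a u v; rewrite /abelian_bracket scaler0 addr0. Qed.
Fact abelian_xx x : abelian_bracket x x = 0.
Proof. by []. Qed.
Fact abelian_jacobi x y z :
  abelian_bracket x (abelian_bracket y z)
  + abelian_bracket y (abelian_bracket z x)
  + abelian_bracket z (abelian_bracket x y) = 0.
Proof. by rewrite /abelian_bracket !addr0. Qed.

HB.instance Definition _ := isLieAlgebra.Build R (abelian_lie R s)
  abelian_linearl abelian_linearr abelian_xx abelian_jacobi.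

End AbelianLie.

Section DirectSumLie.
Variables (R : fieldType) (L1 L2 : lieAlgType R).

Definition dsum_bracket (x y : L1 * L2) : L1 * L2 :=
  (lie x.1 y.1, lie x.2 y.2).

Fact dsum_linearl y : linear (dsum_bracket^~ y).
Proof.
by move=> a u v; congr pair; rewrite /= (lie_linearl y.1, lie_linearl y.2).
Qed.
Fact dsum_linearr x : linear (dsum_bracket x).
Proof.
by move=> a u v; congr pair; rewrite /= (lie_linearr x.1, lie_linearr x.2).
Qed.
Fact dsum_xx x : dsum_bracket x x = 0.
Proof. by rewrite /dsum_bracket !liexx. Qed.
Fact dsum_jacobi x y z :
  dsum_bracket x (dsum_bracket y z) + dsum_bracket y (dsum_bracket z x)
  + dsum_bracket z (dsum_bracket x y) = 0.
Proof. by congr pair; rewrite /= lie_jacobi. Qed.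

HB.instance Definition _ := isLieAlgebra.Build R (L1 * L2)%type
  dsum_linearl dsum_linearr dsum_xx dsum_jacobi.

End DirectSumLie.

(** * Central descending series *)

Section CentralSeries.
Variables (R : fieldType) (L : lieAlgType R).

(* [U, V], spanned by the brackets of basis vectors, in the style of [prodv]. *)
Definition lie_space (U V : {vspace L}) : {vspace L} :=
  <<[seq lie u v | u <- vbasis U, v <- vbasis V]>>%VS.

Fixpoint lower_central (i : nat) : {vspace L} :=
  if i is i'.+1 then lie_space fullv (lower_central i') else fullv.

(* The two conditions force [0 < k]; the zero algebra has no index. *)
Definition nilpotency_index (k : nat) : Prop :=
  lower_central k = 0%VS /\ lower_central k.-1 <> 0%VS.

End CentralSeries.

(** * The Chevalley-Eilenberg complex with trivial real coefficients *)

Section Cochains.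
Unset Implicit Arguments.
Variables (R : realType) (L : lieAlgType R).

Local Notation form p := (('I_p -> L) -> R).

Definition multilinear {p} (c : form p) : Prop :=
  forall (x : 'I_p -> L) (i : 'I_p), scalar (fun v => c [eta x with i |-> v]).

Definition alternating {p} (c : form p) : Prop :=
  forall (x : 'I_p -> L) (i j : 'I_p), i != j -> x i = x j -> c x = 0.

(* Lambda^p L^*; in particular [altform 1] is the dual space L^*. *)
Definition altform (p : nat) : set (form p) :=
  [set c | multilinear c /\ alternating c].

(* Indices start at 0 here, which turns the usual (-1)^(i+j-1) into
   (-1)^(i+j+1); [nth] reads the list [x_i,x_j], x_0, .., x_p with x_i and x_j
   omitted. *)
Definition ce_diff {p} (c : form p) : form p.+1 :=
  fun x => \sum_(i < p.+1) \sum_(j < p.+1 | (i < j)%N)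
    (-1) ^+ (i + j).+1 *
    c (fun k : 'I_p => nth 0
        (lie (x i) (x j) ::
           [seq x m | m <- enum 'I_p.+1 & (m != i) && (m != j)]) k).

(* a_1 /\ .. /\ a_p for 1-forms a_1, .., a_p *)
Definition wedge {p} (a : 'I_p -> form 1) : form p :=
  fun x => \det (\matrix_(i, j) a i (fun=> x j)).

(* Lambda^p V, for a subspace V of L^*, as the subspace of Lambda^p L^* spanned
   by the wedge products of elements of V. *)
Definition ext_power (V : set (form 1)) (p : nat) : set (form p) :=
  [set c | exists (n : nat) (r : 'I_n -> R)
                  (a : 'I_n -> 'I_p -> form 1),
     (forall l i, V (a l i)) /\
     (forall x, c x = \sum_(l < n) r l * wedge (a l) x)].

(** * The filtration and its spectral sequence *)

Fixpoint dual_filtration (i : nat) : set (form 1) :=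
  if i is i'.+1 then
    [set a | altform 1 a /\ ext_power (dual_filtration i') 2 (ce_diff a)]
  else [set 0].

Section SpectralSequence.
(* Below, [k] is the nilpotency index of L, [p] the filtration degree and [m]
   the total degree: the group usually indexed by (p, q) has m = p + q. *)
Variable k : nat.

(* F^p C^m.  The filtration stops at F^k, so F^p = 0 for p > k; truncated
   subtraction alone would give the constants Lambda^0 V_0 there. *)
Definition filtration (p m : nat) : set (form m) :=
  if (p <= k)%N then ext_power (dual_filtration (k - p)) m else [set 0].

(* {x in F^p C^m : d x in F^(p+r) C^(m+1)} *)
Definition cycles (r p m : nat) : set (form m) :=
  [set x | filtration p m x /\ filtration (p + r) m.+1 (ce_diff x)].

(* F^p C^m `&` d (F^(p-r) C^(m-1)); truncation of p - r is harmless, since F^0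
   is the whole complex. *)
Definition boundaries (r p m : nat) : set (form m) :=
  match m return set (form m) with
  | 0 => [set 0]
  | m'.+1 => filtration p m'.+1 `&`
             [set ce_diff y | y in filtration (p - r) m']
  end.

Definition cycles_inf (p m : nat) := \bigcap_r cycles r p m.

Definition boundaries_inf (p m : nat) := \bigcup_r boundaries r p m.

(* The quotient of a subspace Z by a subspace B of it, as the set of cosets. *)
Definition quotient_space {W : zmodType} (Z B : set W) : set (set W) :=
  [set [set z + b | b in B] | z in Z].

(* E_oo^(p, m - p) = Z_oo^p / (Z_oo^(p+1) + B_oo^p) in total degree m *)
Definition E_inf (p m : nat) : set (set (form m)) :=
  quotient_space (cycles_inf p m)
    [set z + b | z in cycles_inf p.+1 m & b in boundaries_inf p m].

End SpectralSequence.

(** * Symplectic structures *)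

Definition nondegenerate (w : form 2) : Prop :=
  forall x : L, (forall y : L, w (tnth [tuple x; y]) = 0) -> x = 0.

Definition symplectic (w : form 2) : Prop :=
  [/\ altform 2 w, ce_diff w = 0 & nondegenerate w].

End Cochains.

Arguments multilinear {R L p} c.
Arguments alternating {R L p} c.
Arguments ce_diff {R L p} c _.
Arguments wedge {R L p} a _.
Arguments altform {R} L p _.
Arguments ext_power {R L} V p _.
Arguments dual_filtration {R} L i _.
Arguments filtration {R} L k p m _.
Arguments cycles {R} L k r p m _.
Arguments boundaries {R} L k r p m _.
Arguments cycles_inf {R} L k p m _.
Arguments boundaries_inf {R} L k p m _.
Arguments E_inf {R} L k p m _.
Arguments nondegenerate {R L} w.
Arguments symplectic {R L} w.

Set Implicit Arguments.

Definition admits_symplectic (R : realType) (L : lieAlgType R) : Prop :=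
  exists w : ('I_2 -> L) -> R, symplectic w.

(* A quotient space is zero when it consists of a single coset. *)
Definition is_zero_space (W : Type) (Q : set (set W)) : Prop :=
  exists X : set W, Q = [set X].

(* Main.v *)
(** If z lies in n^(k-1), the last nonzero term of the central series, then z is
central in R^s + n.  The hypothesis on E_oo^(0,2) says that the restriction of
a closed 2-form w to n lies in Lambda^2 V_(k-1), that is, w(z, n) = 0.
When k > 1, z is a sum of brackets, and closedness of w gives w(z, R^s) = 0
because R^s commutes with n; so z is in the radical of w.  When k = 1, the
hypothesis would make every 2-form on the abelian algebra n vanish, which is
impossible in dimension at least 2. *)

Require Import Defs.
From mathcomp Require Import all_boot all_order all_algebra.
From mathcomp Require Import boolp classical_sets functions reals.
From mathcomp Require Import ring.

Set Implicit Arguments.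
Unset Strict Implicit.
Unset Printing Implicit Defensive.

Import GRing.Theory.
Local Open Scope classical_set_scope.
Local Open Scope ring_scope.

(** * Linear maps and scalar forms *)

Section LinearMaps.
Variables (R : fieldType) (U : lmodType R).

Lemma linear_fun0 (V : lmodType R) (f : U -> V) : linear f -> f 0 = 0.
Proof.
by move=> fl; have := fl (-1) 0 0; rewrite !scaleN1r oppr0 addr0 addNr.
Qed.

Lemma linear_comb (V : lmodType R) (f : U -> V) I (s : seq I) (c : I -> R)
    (e : I -> U) :
  linear f -> f (\sum_(i <- s) c i *: e i) = \sum_(i <- s) c i *: f (e i).
Proof.
move=> fl; elim: s => [|i s IHs]; last by rewrite !big_cons fl IHs.
by rewrite !big_nil linear_fun0.
Qed.

Lemma scalar_comb (f : U -> R) I (s : seq I) (c : I -> R) (e : I -> U) :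
  scalar f -> f (\sum_(i <- s) c i *: e i) = \sum_(i <- s) c i * f (e i).
Proof. exact: (@linear_comb R^o). Qed.

Lemma scalar0 (f : U -> R) : scalar f -> f 0 = 0.
Proof. exact: (@linear_fun0 R^o). Qed.

Lemma scalarD (f : U -> R) u v : scalar f -> f (u + v) = f u + f v.
Proof. by move=> fl; have := fl 1 u v; rewrite scale1r mul1r. Qed.

Lemma scalarB (f : U -> R) u v : scalar f -> f (u - v) = f u - f v.
Proof. by move=> fl; rewrite addrC -scaleN1r fl mulN1r addrC. Qed.

End LinearMaps.

(** * Brackets of subspaces and the central series *)

Section LieSpace.
Variables (R : fieldType) (L : lieAlgType R).
Implicit Types U V : {vspace L}.

Lemma memv_lie U V u v : u \in U -> v \in V -> lie u v \in lie_space U V.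
Proof.
move=> /coord_vbasis-> /coord_vbasis->.
rewrite (linear_comb _ _ _ (lie_linearl _)).
apply: memv_suml => i _; apply: memvZ.
rewrite (linear_comb _ _ _ (lie_linearr _)).
apply: memv_suml => j _; apply: memvZ.
by apply/memv_span/allpairs_f; apply: mem_nth; rewrite size_tuple.
Qed.

(** Brackets of basis vectors span [lie_space U V], so a linear form is tested on brackets only. *)
Lemma lie_space_scalar0 U V (f : L -> R) z : scalar f ->
  (forall u v, u \in U -> v \in V -> f (lie u v) = 0) ->
  z \in lie_space U V -> f z = 0.
Proof.
move=> fl f0; rewrite /lie_space -[X in <<X>>%VS]in_tupleE => /coord_span->.
rewrite scalar_comb//; apply: big1 => i _.
set s := in_tuple _; have /allpairsP[[u v] /= [uU vV ->]] : s`_i \in s.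
  exact: mem_nth.
by rewrite f0 ?mulr0// vbasis_mem.
Qed.

(** Bracketing with [y] moves [z] one step down the series, into the zero term. *)
Lemma lie_top_lower_central k z (y : L) : (0 < k)%N ->
  lower_central L k = 0%VS -> z \in lower_central L k.-1 -> lie y z = 0.
Proof.
case: k => // k _ nk zk; apply/eqP; rewrite -memv0 -nk.
exact: memv_lie (memvf y) zk.
Qed.

End LieSpace.

(** * Cochains of degree 1 and 2 *)

Section Forms.
Variables (R : realType) (L : lieAlgType R).
Local Notation form p := (('I_p -> L) -> R).

Definition pairf (w : form 2) (x y : L) := w (tnth [tuple x; y]).

Lemma pairfE (w : form 2) x : w x = pairf w (x ord0) (x ord_max).
Proof.
rewrite /pairf; congr w; apply/funext => i.
by case: i => [[|[|//]] ?]; congr (x _); exact: val_inj.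
Qed.

Lemma form1E (a : form 1) x : a x = a (fun=> x ord0).
Proof. by congr a; apply/funext => i; rewrite [i]ord1. Qed.

(** Only the pair (0, 1) contributes; its sign is (-1)^2, so no minus sign appears. *)
Lemma ce_diff1E (a : form 1) x :
  ce_diff a x = a (fun=> lie (x ord0) (x ord_max)).
Proof.
rewrite /ce_diff !big_ord_recl !big_ord0 /= !addr0.
do 2![rewrite big_mkcond !big_ord_recl big_ord0 /= ?addr0 ?add0r].
have -> : ord_max = lift ord0 ord0 :> 'I_2 by exact: val_inj.
by rewrite form1E -signr_odd /= mul1r.
Qed.

Lemma ce_diff2E (w : form 2) x (i1 : 'I_3 := lift ord0 ord0) :
  ce_diff w x = pairf w (lie (x ord0) (x i1)) (x ord_max)
    - pairf w (lie (x ord0) (x ord_max)) (x i1)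
    + pairf w (lie (x i1) (x ord_max)) (x ord0).
Proof.
have -> : ord_max = lift ord0 (lift ord0 ord0) :> 'I_3 by exact: val_inj.
rewrite /ce_diff !big_ord_recl !big_ord0 /= !addr0.
do 3![rewrite big_mkcond !big_ord_recl big_ord0 /= ?addr0 ?add0r].
rewrite !enum_ordSl /= !pairfE /= !(addn0, add0n, addn1) !exprS expr0; ring.
Qed.

Lemma wedge2E (a : 'I_2 -> form 1) x :
  wedge a x = a ord0 (fun=> x ord0) * a ord_max (fun=> x ord_max)
            - a ord0 (fun=> x ord_max) * a ord_max (fun=> x ord0).
Proof.
have -> : ord_max = lift ord0 ord0 :> 'I_2 by exact: val_inj.
rewrite /wedge (expand_det_row _ ord0) !big_ord_recl big_ord0 addr0.
rewrite /cofactor !det_mx11 !mxE /= expr0 expr1 mul1r mulN1r mulrN.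
by have -> : lift (lift ord0 ord0) 0 = ord0 :> 'I_2 by exact: val_inj.
Qed.

Lemma scalar_altform1 (a : form 1) :
  altform L 1 a -> scalar (fun v => a (fun=> v)).
Proof.
move=> [al _] c u v.
(* With a single index, the base point updated in [multilinear] is irrelevant. *)
have aE t : a [eta fun=> 0 with ord0 |-> t] = a (fun=> t) by exact: form1E.
by rewrite -!aE al.
Qed.

Lemma altform1P (f : L -> R) : scalar f -> altform L 1 (fun x => f (x ord0)).
Proof.
move=> fl; split=> [x i c u v|x i j]; first by rewrite !ord1 /= fl.
by rewrite !ord1.
Qed.

Lemma altform2P (B : L -> L -> R) :
  (forall y, scalar (B^~ y)) -> (forall x, scalar (B x)) ->
  (forall x, B x x = 0) -> altform L 2 (fun x => B (x ord0) (x ord_max)).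
Proof.
move=> Bl Br B0; have ord2 (i : 'I_2) : i = ord0 \/ i = ord_max.
  by case: i => [[|[|//]] ?]; [left|right]; exact: val_inj.
split=> [x i c u v|x i j].
  by case: (ord2 i) => -> /=; rewrite ?Bl ?Br.
by case: (ord2 i) (ord2 j) => -> [] -> // _ ->; rewrite B0.
Qed.

Section Pairf.
Variables (w : form 2) (walt : altform L 2 w).

Lemma pairf_linearl y : scalar (pairf w ^~ y).
Proof.
move=> c u v; have := walt.1 (tnth [tuple 0; y]) ord0 c u v.
by rewrite !pairfE.
Qed.

Lemma pairf_linearr x : scalar (pairf w x).
Proof.
move=> c u v; have := walt.1 (tnth [tuple x; 0]) ord_max c u v.
by rewrite !pairfE.
Qed.

Lemma pairfxx x : pairf w x x = 0.
Proof. by apply: (walt.2 _ ord0 ord_max). Qed.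

Lemma pairf_anti x y : pairf w x y = - pairf w y x.
Proof.
apply/eqP; rewrite -addr_eq0; apply/eqP.
have := pairfxx (x + y); rewrite (scalarD _ _ (pairf_linearl _)).
by rewrite !(scalarD _ _ (pairf_linearr _)) !pairfxx add0r addr0.
Qed.

End Pairf.

Lemma pairf_ce_diff1 (a : form 1) x y :
  pairf (ce_diff a) x y = a (fun=> lie x y).
Proof. by rewrite /pairf ce_diff1E. Qed.

Lemma altform_ce_diff1 (a : form 1) : altform L 1 a -> altform L 2 (ce_diff a).
Proof.
move=> /scalar_altform1 al.
have -> : ce_diff a = fun x => a (fun=> lie (x ord0) (x ord_max)).
  by apply/funext => x; rewrite ce_diff1E.
apply: (altform2P (B := fun x y => a (fun=> lie x y))) => [y|x|x].
- by move=> c u v; rewrite lie_linearl al.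
- by move=> c u v; rewrite lie_linearr al.
- by rewrite liexx (scalar0 al).
Qed.

(** * Exterior squares of annihilators and the filtration of the dual space *)

Definition annihilator (U : {vspace L}) : set (form 1) :=
  [set a | altform L 1 a /\ forall u, u \in U -> a (fun=> u) = 0].

(** Both products in a wedge of two 1-forms contain an evaluation at [u]. *)
Lemma ext_power_annihilator2 (U : {vspace L}) (w : form 2) u y :
  ext_power (annihilator U) 2 w -> u \in U -> pairf w y u = 0.
Proof.
move=> [N [r [a [aU wE]]]] uU; rewrite /pairf wE; apply: big1 => l _.
have au t : a l t (fun=> u) = 0 by exact: (aU l t).2.
by rewrite wedge2E /= !au mul0r mulr0 subrr mulr0.
Qed.

(* Expand w in the coordinates of x minus its projection on U, which vanish on
   U; the factor 1/2 comes from summing over all pairs (i, j). *)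
Lemma altform2_ext_power (U : {vspace L}) (w : form 2) : altform L 2 w ->
  (forall u y, u \in U -> pairf w u y = 0) -> ext_power (annihilator U) 2 w.
Proof.
move=> walt wU; pose N : nat := \dim (fullv : {vspace L}).
pose e : N.-tuple L := vbasis fullv.
pose P x := x - projv U x; pose c (i : 'I_N) (x : L) : R := coord e i (P x).
(* [ext_power] wants a sum indexed by an ordinal, so pairs of indices are enumerated through [p]. *)
pose T : finType := ('I_N * 'I_N)%type; pose p (l : 'I_#|T|) : T := enum_val l.
have wP x y : pairf w x y = pairf w (P x) (P y).
  have wl z t : pairf w (projv U z) t = 0 by exact/wU/memv_proj.
  rewrite (scalarB _ _ (pairf_linearl walt _)) wl subr0.
  rewrite (scalarB _ _ (pairf_linearr walt _)) [X in _ - X](pairf_anti walt).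
  by rewrite wl oppr0 subr0.
have PE x : P x = \sum_(i < N) c i x *: e`_i by exact/coord_vbasis/memvf.
exists #|T|, (fun l => 2^-1 * pairf w e`_(p l).1 e`_(p l).2).
exists (fun l t x => if t == ord0 then c (p l).1 (x ord0)
                     else c (p l).2 (x ord0)).
have cl i : scalar (c i).
  move=> a x y; rewrite -[RHS]linearP; congr (coord e i _).
  by rewrite /P linearP opprD addrACA scalerBr.
have cann i : annihilator U (fun x => c i (x ord0)).
  split; first exact: (altform1P (cl i)).
  by move=> u uU; rewrite /c /P projv_id// subrr; exact: linear0.
split=> [l t|x]; first by case: (t == ord0); exact: cann.
pose F (t : T) := 2^-1 * pairf w e`_t.1 e`_t.2 *
  (c t.1 (x ord0) * c t.2 (x ord_max) - c t.1 (x ord_max) * c t.2 (x ord0)).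
under eq_bigr do rewrite wedge2E /= -[_ * _]/(F _).
rewrite -(big_enum_val (A := T) F) -(pair_bigA _ (fun i j => F (i, j))) /=.
have wE u v :
    pairf w u v = \sum_(i < N) \sum_(j < N) c i u * c j v * pairf w e`_i e`_j.
  rewrite wP PE (scalar_comb _ _ _ (pairf_linearl walt _)).
  apply: eq_bigr => i _.
  rewrite PE (scalar_comb _ _ _ (pairf_linearr walt _)) mulr_sumr.
  by apply: eq_bigr => j _; rewrite mulrA.
transitivity
  (2^-1 * (pairf w (x ord0) (x ord_max) - pairf w (x ord_max) (x ord0))).
  by rewrite pairfE [X in _ - X](pairf_anti walt); field.
rewrite !wE -sumrB mulr_sumr; apply: eq_bigr => i _.
rewrite -sumrB mulr_sumr; apply: eq_bigr => j _.
by rewrite /F /=; ring.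
Qed.

(** Induction on [i]. As da(x, y) = a([x, y]), the form [a] kills [n, n^i] exactly when n^i lies in
    the radical of da, which by the two lemmas on [ext_power] means that da is in Lambda^2 of the
    annihilator of n^i. *)
Lemma dual_filtrationE i :
  dual_filtration L i = annihilator (lower_central L i).
Proof.
elim: i => [|i IHi] /=.
  apply/seteqP; split=> [a ->|a [_ a0]].
    split=> //; split=> [x j c u v|//]; first by rewrite mulr0 addr0.
  by apply/funext => x; rewrite form1E a0 ?memvf.
rewrite IHi; apply/seteqP; split=> a [aalt aP]; split=> //.
  move=> u; apply: (lie_space_scalar0 (scalar_altform1 aalt)) => x y _ yi.
  by rewrite -pairf_ce_diff1; exact: ext_power_annihilator2 aP yi.
apply: altform2_ext_power => [|u y ui]; first exact: altform_ce_diff1.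
rewrite (pairf_anti (altform_ce_diff1 aalt)) pairf_ce_diff1 aP ?oppr0//.
exact: memv_lie (memvf y) ui.
Qed.

(** * The spectral sequence in total degree 2 *)

Lemma ext_power0 (V : set (form 1)) p : ext_power V p (0 : form p).
Proof.
exists 0, (fun=> 0), (fun=> fun=> 0); split=> [[]//|x].
by rewrite big_ord0.
Qed.

(** A wedge of one form is a 1 x 1 determinant. This makes the primitive of a boundary a genuine
    linear form. *)
Lemma ext_power1 (V : set (form 1)) y : V `<=` altform L 1 -> ext_power V 1 y ->
  altform L 1 y.
Proof.
move=> Valt [N [r [a [aV yE]]]].
suff -> : y = fun x => \sum_(l < N) r l * a l ord0 (fun=> x ord0).
  apply: (altform1P (f := fun v => \sum_(l < N) r l * a l ord0 (fun=> v))).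
  move=> c u v; rewrite mulr_sumr -big_split; apply: eq_bigr => l _ /=.
  by rewrite (scalar_altform1 (Valt _ (aV l ord0))); ring.
apply/funext => x; rewrite yE; apply: eq_bigr => l _.
by rewrite /wedge det_mx11 mxE.
Qed.

Lemma filtration0 k p m : filtration L k p m (0 : form m).
Proof. by rewrite /filtration; case: ifP => // _; exact: ext_power0. Qed.

Lemma ce_diff0 p : ce_diff (0 : form p) = 0.
Proof.
apply/funext => x; rewrite /ce_diff big1// => i _; rewrite big1// => j _.
exact: mulr0.
Qed.

Section EInfZero.
Variables (k : nat) (k0 : (0 < k)%N) (nk : lower_central L k = 0%VS).
Variable hE : is_zero_space (E_inf L k 0 2).

(** The annihilator of n^k = 0 is the whole dual, so F^0 C^2 contains every alternating 2-form; dw =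
    0 lies in every F^r. *)
Lemma closed_cycles_inf (w : form 2) :
  altform L 2 w -> ce_diff w = 0 -> cycles_inf L k 0 2 w.
Proof.
move=> walt w0 r _; split; last by rewrite w0; exact: filtration0.
rewrite /filtration /= subn0 dual_filtrationE.
apply: altform2_ext_power => // u y; rewrite nk memv0 => /eqP ->.
exact: scalar0 (pairf_linearl walt y).
Qed.

(* A coboundary d a also pairs to zero with the last nonzero term of the
   central series, because that term is central. *)
Lemma closed_form_lower_central (w : form 2) y z :
  altform L 2 w -> ce_diff w = 0 -> z \in lower_central L k.-1 ->
  pairf w y z = 0.
Proof.
move=> walt w0 zk; have wZ := closed_cycles_inf walt w0.
have zZ p : cycles_inf L k p 2 0.
  by move=> r _; split; rewrite ?ce_diff0; exact: filtration0.
have zB : boundaries_inf L k 0 2 0.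
  exists 0 => //; split; first exact: filtration0.
  by exists 0; [exact: filtration0|exact: ce_diff0].
case: hE => X; rewrite /E_inf; set B := (Y in quotient_space _ Y) => EX.
have B0 : B 0 by exists 0 => //; exists 0 => //; rewrite addr0.
(* All cosets coincide, so [w] lies in the coset of 0, that is, in [B]. *)
have coset v : cycles_inf L k 0 2 v -> [set v + b | b in B] = X.
  by move=> vZ; have : [set X] [set v + b | b in B] by rewrite -EX; exists v.
have : [set 0 + b | b in B] w.
  by rewrite coset// -(coset w wZ); exists 0 => //; rewrite addr0.
(* Thus w = c + da with [c] in Z_oo^1 and [a] in F^0 C^1. *)
move=> [_ [c cZ [b [r _ [_ [a aF <-]]]] <-] <-].
rewrite add0r -[pairf _ _ _]/(pairf c y z + pairf (ce_diff a) y z).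
rewrite pairf_ce_diff1 (lie_top_lower_central _ k0 nk zk).
have /scalar_altform1/scalar0 -> : altform L 1 a.
  move: aF; rewrite sub0n /filtration /=; apply: ext_power1.
  by rewrite subn0 dual_filtrationE => ? [].
(* The cycle condition at r = 0 already puts [c] in F^1 C^2 = Lambda^2 V_(k-1). *)
have [+ _] := cZ 0 I; rewrite /filtration k0 subn1 dual_filtrationE addr0.
by move=> /ext_power_annihilator2; apply.
Qed.

End EInfZero.

(** The witness is the wedge of the first two coordinate forms of a basis, evaluated on the two
    matching basis vectors. *)
Lemma abelian_closed_form_neq0 : (1 < \dim (fullv : {vspace L}))%N ->
  (forall x y : L, lie x y = 0) ->
  exists w x y, [/\ altform L 2 w, ce_diff w = 0 & pairf w x y = 1].
Proof.
move=> dimL lie0; set e := vbasis (fullv : {vspace L}).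
pose i0 := Ordinal (ltnW dimL); pose i1 := Ordinal dimL.
pose c i (x : L) : R := coord e i x.
have cl i : scalar (c i) by move=> a x y; exact: linearP.
pose B x y := c i0 x * c i1 y - c i0 y * c i1 x.
have walt : altform L 2 (fun x => B (x ord0) (x ord_max)).
  apply: altform2P => [y a u v|x a u v|x]; rewrite /B ?cl; ring.
exists (fun x => B (x ord0) (x ord_max)), e`_i0, e`_i1; split=> //.
  apply/funext => x; rewrite ce_diff2E !lie0.
  by rewrite !(scalar0 (pairf_linearl walt _)) subrr addr0.
have cE i (j : 'I__) : c i e`_j = (j == i)%:R.
  exact: coord_free (basis_free (vbasisP _)).
by rewrite -[LHS]/(B e`_i0 e`_i1) /B !(cE _ i0) !(cE _ i1) /= mulr1 mulr0 subr0.
Qed.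

End Forms.

(** * Forms on a direct sum of Lie algebras *)

Section Embedding.
Variables (R : realType) (L1 L2 : lieAlgType R).

Lemma lie_pair0 (x y : L2) : lie (0, x) (0, y) = (0, lie x y) :> L1 * L2.
Proof. by congr pair; exact: liexx. Qed.

Lemma inr_comb c (u v : L2) :
  (0, c *: u + v) = c *: (0, u) + (0, v) :> L1 * L2.
Proof. by congr pair; rewrite /= scaler0 addr0. Qed.

Lemma altform2_snd (w : ('I_2 -> L1 * L2) -> R) : altform _ 2 w ->
  altform L2 2 (fun x => w (fun i => (0, x i))).
Proof.
move=> walt.
rewrite (_ : (fun _ => _) =
  fun x => pairf w (0, x ord0) (0, x ord_max)); last first.
  by apply/funext => x; rewrite pairfE.
apply: (altform2P (B := fun x y => pairf w (0, x) (0, y))) => [y|x|x].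
- by move=> c u v; rewrite inr_comb pairf_linearl.
- by move=> c u v; rewrite inr_comb pairf_linearr.
- exact: pairfxx.
Qed.

(** The inclusion of the second factor is a Lie algebra morphism, so pullback along it commutes with
    d. *)
Lemma ce_diff2_snd (w : ('I_2 -> L1 * L2) -> R) x :
  ce_diff (fun x : 'I_2 -> L2 => w (fun i => (0, x i))) x =
  ce_diff w (fun i => (0, x i)).
Proof.
rewrite !ce_diff2E !lie_pair0 /pairf.
by congr (_ - _ + _); rewrite -[LHS]/(w _) pairfE.
Qed.

(* The factors commute, so dw((0, u), (0, v), (a, 0)) has a single nonzero
   term. *)
Lemma closed_form_cross (w : ('I_2 -> L1 * L2) -> R) (a : L1)
    (U V : {vspace L2}) z :
  altform _ 2 w -> ce_diff w = 0 -> z \in lie_space U V ->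
  pairf w (0, z) (a, 0) = 0.
Proof.
move=> walt w0.
apply: (lie_space_scalar0 (f := fun z => pairf w (0, z) (a, 0))).
  by move=> c u v; rewrite inr_comb pairf_linearl.
move=> u v _ _; have := congr1 (@^~ (tnth [tuple (0, u); (0, v); (a, 0)])) w0.
have cross t : lie (0, t) (a, 0) = 0 :> L1 * L2.
  by congr pair; [exact: linear_fun0 (lie_linearl _)
                 |exact: linear_fun0 (lie_linearr _)].
rewrite ce_diff2E /= lie_pair0 !cross !(scalar0 (pairf_linearl walt _)).
by rewrite subr0 addr0.
Qed.

End Embedding.

Theorem theorem3p2 (R : realType) (n : lieAlgType R) (k : nat)
    (hdim : (1 < \dim (fullv : {vspace n}))%N)
    (hk : nilpotency_index n k)
    (hE : is_zero_space (E_inf n k 0 2)) :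
  forall s : nat, ~ admits_symplectic (abelian_lie R s * n)%type.
Proof.
move=> s [w [walt w0 wnd]]; case: hk => nk nk1.
case: k => [|[|k]] in nk nk1 hE.
(* For index 0, [k.-1] is 0 as well, and the two conditions contradict each other. *)
- by rewrite /= in nk1 nk.
- have lie0 x y : lie x y = 0 :> n.
    exact: (lie_top_lower_central x (ltn0Sn 0) nk (memvf y)).
  have [v [x [y [valt v0 v1]]]] := abelian_closed_form_neq0 hdim lie0.
  have := closed_form_lower_central (ltn0Sn 0) nk hE x valt v0 (memvf y).
  by rewrite v1 => /eqP; rewrite oner_eq0.
(* The index is now [k.+2], so the last nonzero term [lower_central n k.+1] is a [lie_space], as
   [closed_form_cross] requires. *)
set z := vpick (lower_central n k.+1).
have zk : z \in lower_central n k.+1 by exact: memv_pick.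
have z0 : z != 0 by rewrite vpick0; exact/eqP.
suff [/eqP] : (0, z) = 0 :> abelian_lie R s * n by rewrite (negPf z0).
apply: wnd => -[a b]; rewrite -[w _]/(pairf w _ _).
have -> : (a, b) = (a, 0) + (0, b) :> abelian_lie R s * n.
  by congr pair; rewrite /= ?addr0 ?add0r.
rewrite (scalarD _ _ (pairf_linearr walt _)) (closed_form_cross _ walt w0 zk).
rewrite add0r (pairf_anti walt); apply/eqP; rewrite oppr_eq0; apply/eqP.
(* What remains is w(z, b) with both arguments in n: the restriction of [w] to n is closed, so the
   hypothesis on E_oo applies. *)
have r0 : ce_diff (fun x : 'I_2 -> n => w (fun i => (0, x i))) = 0.
  by apply/funext => x; rewrite ce_diff2_snd w0.
have := closed_form_lower_central (ltn0Sn _) nk hE b (altform2_snd walt) r0 zk.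
by rewrite {1}/pairf pairfE.
Qed.
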